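(* Let $M$ be a smooth manifold and $\sigma\in\Omega^2_{closed}(M)$ a closed $2$-form. There is a canonical morphism of Lie 2-algebras $$\phi\colon\big(\Gamma(E^0),[\cdot,\cdot]_\sigma\big)\rightsquigarrow\big(C^\infty(M)\xrightarrow{d}\Gamma(E^1),[\cdot,\cdot]',J'\big)$$ given by $$\phi_0\colon\Gamma(E^0)\to\Gamma(E^1),\quad (X,f)\mapsto(X,df),$$ $$\phi_2\colon\wedge^2\Gamma(E^0)\to C^\infty(M),\quad (X,f),(Y,g)\mapsto\tfrac12\big(X(g)-Y(f)\big)+\sigma(X,Y).$$
   Context: $E^0=TM\oplus\mathbb R$ (trivial line bundle), and $\Gamma(E^0)$ carries the Lie bracket $[X+f,Y+g]_\sigma=[X,Y]+(X(g)-Y(f))+\sigma(X,Y)$; it is regarded as a Lie 2-algebra concentrated in degree $0$ (all other brackets zero). $E^1=TM\oplus T^*M$ carries the pairing $\langle X+\alpha,Y+\beta\rangle=\iota_X\beta+\iota_Y\alpha$ and the Courant bracket $[\![X+\alpha,Y+\beta]\!]_{Cou}=[X,Y]+\mathcal{L}_X\beta-\mathcal{L}_Y\alpha-\frac12d(\iota_X\beta-\iota_Y\alpha)$. The second Lie 2-algebra has $C^\infty(M)$ in degree $-1$, $\Gamma(E^1)$ in degree $0$, differential the de Rham differential $d$, binary bracket $[e_1,e_2]'=[\![e_1,e_2]\!]_{Cou}$ for $e_i\in\Gamma(E^1)$ and $[e,f]'=-[f,e]'=\frac12\langle e,df\rangle$ for $e\in\Gamma(E^1)$, $f\in C^\infty(M)$,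 trinary bracket $J'(e_1,e_2,e_3)=-\frac16\big(\langle[\![e_1,e_2]\!]_{Cou},e_3\rangle+\text{cyclic permutations}\big)$ for $e_i\in\Gamma(E^1)$, and all other brackets zero. A Lie 2-algebra is an $L_\infty$-algebra on a graded vector space $V=V_{-1}\oplus V_0$, with operations $d$ (unary, degree $1$), $[\cdot,\cdot]$ (binary, degree $0$), $J$ (trinary, degree $-1$). A morphism $\phi\colon(V,d,[\cdot,\cdot],J)\rightsquigarrow(V',d',[\cdot,\cdot]',J')$ of Lie 2-algebras consists of linear maps $\phi_0\colon V_0\to V'_0$, $\phi_1\colon V_{-1}\to V'_{-1}$, $\phi_2\colon\wedge^2V_0\to V'_{-1}$ such that $d'\circ\phi_1=\phi_0\circ d$; $d'(\phi_2(x,y))=\phi_0[x,y]-[\phi_0(x),\phi_0(y)]'$ for $x,y\in V_0$; $\phi_2(df,y)=\phi_1[f,y]-[\phi_1(f),\phi_0(y)]'$ for $f\in V_{-1}$, $y\in V_0$; and for all $x,y,z\in V_0$ $$\phi_1(J(x,y,z))-J'(\phi_0(x),\phi_0(y),\phi_0(z))=\phi_2(x,[y,z])-\phi_2(y,[x,z])+\phi_2(z,[x,y])+[\phi_0(x),\phi_2(y,z)]'-[\phi_0(y),\phi_2(x,z)]'+[\phi_0(z),\phi_2(x,y)]'.$$ Here, since the source is concentrated in degree $0$, $\phi_1=0$ and $J=0$. *)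

(* Defs.v *)
From HB Require Import structures.
From mathcomp Require Import all_boot all_order all_algebra.
From mathcomp Require Import ring lra.
From mathcomp Require Import all_classical all_reals all_analysis.

Set Implicit Arguments.
Unset Strict Implicit.
Unset Printing Implicit Defensive.

Import Order.TTheory GRing.Theory Num.Theory.
Import numFieldNormedType.Exports.

Local Open Scope classical_set_scope.
Local Open Scope ring_scope.

(** * Lie 2-algebras *)

(* An L_infinity-algebra on V_{-1} + V_0, written out degree by degree.  The
   binary bracket is [br0] on V_0 x V_0 and [br1] on V_0 x V_{-1}; on
   V_{-1} x V_0 it is [f, x] = - [x, f], and it vanishes on V_{-1} x V_{-1} for
   degree reasons, as does J unless all its arguments are in V_0.  Bilinearity
   of [br0] and trilinearity of [jac] follow from linearity in the last argument
   and antisymmetry.  The five identities are those of Lada-Markl,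
     sum_(i + j = n + 1) sum_(unshuffles s) (-1)^(i (j - 1)) chi(s)
       l_j (l_i (x_s(1), ..., x_s(i)), x_s(i+1), ..., x_s(n)) = 0,
   with l_1 = d, l_2 = [.,.], l_3 = J, for n = 2 (two cases), n = 3 (two cases)
   and n = 4. *)
Record lie2alg (R : realType) := Lie2Alg {
  deg0 : lmodType R;
  degm1 : lmodType R;
  dlie : degm1 -> deg0;
  br0 : deg0 -> deg0 -> deg0;
  br1 : deg0 -> degm1 -> degm1;
  jac : deg0 -> deg0 -> deg0 -> degm1;
  dlie_linear : linear dlie;
  br0_linear : forall x, linear (br0 x);
  br0_anti : forall x y, br0 y x = - br0 x y;
  br1_linear : forall x, linear (br1 x);
  br1_linearl : forall f, linear (br1^~ f);
  jac_linear : forall x y, linear (jac x y);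
  jac_anti12 : forall x y z, jac y x z = - jac x y z;
  jac_anti23 : forall x y z, jac x z y = - jac x y z;
  dlie_br1 : forall x f, dlie (br1 x f) = br0 x (dlie f);
  (* [df, g] = [f, dg] *)
  br1_dlie : forall f g, br1 (dlie f) g = - br1 (dlie g) f;
  br0_jacobi : forall x y z,
    br0 x (br0 y z) + br0 y (br0 z x) + br0 z (br0 x y) = dlie (jac x y z);
  br1_jacobi : forall x y f,
    br1 x (br1 y f) - br1 y (br1 x f) - br1 (br0 x y) f = jac x y (dlie f);
  jac_coherence : forall x y z w,
    br1 x (jac y z w) - br1 y (jac x z w) + br1 z (jac x y w)
      - br1 w (jac x y z)
    = jac (br0 x y) z w - jac (br0 x z) y w + jac (br0 x w) y z
      + jac (br0 y z) x w - jac (br0 y w) x z + jac (br0 z w) x y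
}.

Definition brm1 (R : realType) (L : lie2alg R) (f : degm1 L) (x : deg0 L) :
  degm1 L := - br1 x f.

Record lie2_morphism (R : realType) (L L' : lie2alg R)
    (phi0 : deg0 L -> deg0 L') (phi1 : degm1 L -> degm1 L')
    (phi2 : deg0 L -> deg0 L -> degm1 L') : Prop := Lie2Morphism {
  phi0_linear : linear phi0;
  phi1_linear : linear phi1;
  phi2_linear : forall x, linear (phi2 x);
  phi2_anti : forall x y, phi2 y x = - phi2 x y;
  phi_diff : forall f, dlie (phi1 f) = phi0 (dlie f);
  phi_br0 : forall x y,
    dlie (phi2 x y) = phi0 (br0 x y) - br0 (phi0 x) (phi0 y);
  phi_br1 : forall f y,
    phi2 (dlie f) y = phi1 (brm1 f y) - brm1 (phi1 f) (phi0 y);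
  phi_jac : forall x y z,
    phi1 (jac x y z) - jac (phi0 x) (phi0 y) (phi0 z)
    = phi2 x (br0 y z) - phi2 y (br0 x z) + phi2 z (br0 x y)
      + br1 (phi0 x) (phi2 y z) - br1 (phi0 y) (phi2 x z)
      + br1 (phi0 z) (phi2 x y)
}.

(** * Smooth manifolds *)

Section SmoothEuclidean.
Variables (R : realType) (n : nat).

Fixpoint Ck_on (k : nat) (V : set 'rV[R]_n) (g : 'rV[R]_n -> R) : Prop :=
  (forall x, V x -> {for x, continuous g}) /\
  if k is k'.+1 then
    forall i : 'I_n,
      (forall x, V x -> derivable g x (delta_mx 0 i)) /\
      Ck_on k' V (fun x => 'D_(delta_mx 0 i) g x)
  else True.

Definition smooth_on (V : set 'rV[R]_n) (g : 'rV[R]_n -> R) : Prop :=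
  forall k, Ck_on k V g.

Lemma Ck_congr k (V : set 'rV[R]_n) f g : open V ->
  (forall x, V x -> f x = g x) -> Ck_on k V f -> Ck_on k V g.
Proof.
move=> oV; elim: k f g => [|k IH] f g fg /=.
  case=> cf _; split=> // x Vx.
  have nfg : \forall y \near nbhs x, f y = g y.
    by apply: filterS (open_nbhs_nbhs (conj oV Vx)) => y; apply: fg.
  rewrite /prop_for /continuous_at -fg//.
  exact: cvg_trans (near_eq_cvg nfg) (cf x Vx).
have nfg x : V x -> \forall y \near nbhs x, f y = g y.
  by move=> Vx; apply: filterS (open_nbhs_nbhs (conj oV Vx)) => y; apply: fg.
case=> cf df; split=> [x Vx|i].
  rewrite /prop_for /continuous_at -fg//.
  exact: cvg_trans (near_eq_cvg (nfg x Vx)) (cf x Vx).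
have [df1 df2] := df i; split=> [x Vx|].
  exact: near_eq_derivable (nfg x Vx) (df1 x Vx).
by apply: IH df2 => x Vx; apply: near_eq_derive; exact: nfg.
Qed.

Lemma Ck_cst k (V : set 'rV[R]_n) (a : R) : Ck_on k V (cst a).
Proof.
elim: k a => [|k IH] a; (split; first by move=> x _; exact: cst_continuous) => // i.
split=> [x _|]; first exact: derivable_cst.
rewrite (_ : (fun _ => _) = cst 0); first exact: IH.
by apply/funext => x; rewrite derive_cst.
Qed.

Lemma Ck_weak k (V : set 'rV[R]_n) f : Ck_on k.+1 V f -> Ck_on k V f.
Proof.
elim: k f => [|k IH] f; first by case.
move=> [cf df]; split=> // i; have [df1 df2] := df i; split=> //.
exact: IH.
Qed.

Lemma Ck_add k (V : set 'rV[R]_n) f g : open V ->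
  Ck_on k V f -> Ck_on k V g -> Ck_on k V (f + g).
Proof.
move=> oV; elim: k f g => [|k IH] f g [cf df] [cg dg];
  (split; first by move=> x Vx; apply: continuousD; [exact: cf|exact: cg]) => //.
move=> i.
have [[df1 df2] [dg1 dg2]] := (df i, dg i); split=> [x Vx|].
  by apply: derivableD; [exact: df1|exact: dg1].
apply: Ck_congr (IH _ _ df2 dg2) => // x Vx.
by rewrite deriveD//; [exact: df1|exact: dg1].
Qed.

Lemma Ck_mul k (V : set 'rV[R]_n) f g : open V ->
  Ck_on k V f -> Ck_on k V g -> Ck_on k V (f * g).
Proof.
move=> oV; elim: k f g => [|k IH] f g hf hg.
  case: hf hg => [cf _] [cg _]; split=> // x Vx.
  by apply: continuousM; [exact: cf|exact: cg].
have [fk gk] := (Ck_weak hf, Ck_weak hg).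
case: hf hg => [cf df] [cg dg]; split=> [x Vx|i].
  by apply: continuousM; [exact: cf|exact: cg].
have [[df1 df2] [dg1 dg2]] := (df i, dg i); split=> [x Vx|].
  by apply: derivableM; [exact: df1|exact: dg1].
apply: Ck_congr (Ck_add oV (IH _ _ fk dg2) (IH _ _ gk df2)) => // x Vx.
by rewrite deriveM//; [exact: df1|exact: dg1].
Qed.

End SmoothEuclidean.

(* [chart_inv] matters only on the open set [chart_map @` chart_dom], where it
   is the inverse of [chart_map]. *)
Record chart (R : realType) (n : nat) (M : topologicalType) := Chart {
  chart_dom : set M;
  chart_map : M -> 'rV[R]_n;
  chart_inv : 'rV[R]_n -> M;
  chart_dom_open : open chart_dom;
  chart_cod_open : open (chart_map @` chart_dom);
  chart_mapK : forall p, chart_dom p -> chart_inv (chart_map p) = p;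
  chart_map_continuous : forall p, chart_dom p -> {for p, continuous chart_map};
  chart_inv_continuous : forall x, (chart_map @` chart_dom) x ->
    {for x, continuous chart_inv}
}.

Record manifold (R : realType) (n : nat) := Manifold {
  space :> topologicalType;
  space_hausdorff : hausdorff_space space;
  space_second_countable : @second_countable space;
  atlas : set (chart R n space);
  atlas_cover : forall p : space, exists2 c, atlas c & chart_dom c p;
  atlas_smooth : forall c c', atlas c -> atlas c' -> forall j : 'I_n,
    smooth_on (chart_map c @` (chart_dom c `&` chart_dom c'))
      (fun x => chart_map c' (chart_inv c x) 0 j)
}.

Arguments atlas {R n} m.
Arguments chart_cod_open {R n M} c.

Section SmoothFunctions.
Variables (R : realType) (n : nat) (M : manifold R n).

Definition smooth (f : M -> R) : Prop :=
  forall c, atlas M c ->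
    smooth_on (chart_map c @` chart_dom c) (f \o chart_inv c).

Definition smooth_pred : {pred M -> R} := fun f => `[< smooth f >].

Lemma smooth_pred_subring : subring_closed smooth_pred.
Proof.
have cstP a : smooth (cst a).
  move=> c _ k; exact: (@Ck_cst _ _ k _ a).
have addP f g : smooth f -> smooth g -> smooth (f + g).
  move=> hf hg c hc k; exact: Ck_add (chart_cod_open c) (hf c hc k) (hg c hc k).
have mulP f g : smooth f -> smooth g -> smooth (f * g).
  move=> hf hg c hc k; exact: Ck_mul (chart_cod_open c) (hf c hc k) (hg c hc k).
split; first by apply/asboolP; exact: cstP.
- move=> f g /asboolP hf /asboolP hg; apply/asboolP; apply: addP => //.
  rewrite (_ : - g = cst (-1) * g); first exact: mulP.
  by apply/funext => p; rewrite !fctE mulN1r.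
- by move=> f g /asboolP hf /asboolP hg; apply/asboolP; apply: mulP.
Qed.

HB.instance Definition _ :=
  GRing.isSubringClosed.Build (M -> R) smooth_pred smooth_pred_subring.

Lemma smooth_pred_scale : GRing.scaler_closed smooth_pred.
Proof.
move=> a f hf; rewrite (_ : a *: f = cst a * f).
  apply: rpredM => //; apply/asboolP => c _ k; exact: (@Ck_cst _ _ k _ a).
by apply/funext => p; rewrite !fctE.
Qed.

HB.instance Definition _ :=
  GRing.isScaleClosed.Build R (M -> R) smooth_pred smooth_pred_scale.

Record smooth_fun := SmoothFun {
  smooth_fun_val :> M -> R;
  smooth_funP : smooth_fun_val \in smooth_pred
}.

HB.instance Definition _ := [isSub for smooth_fun_val].
HB.instance Definition _ := [Choice of smooth_fun by <:].
HB.instance Definition _ :=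
  GRing.SubChoice_isSubComPzRing.Build _ _ smooth_fun (subringClosedP _).
HB.instance Definition _ := [SubZmodule_isSubLmodule of smooth_fun by <:].

End SmoothFunctions.
(** * Cartan calculus *)

Section SmoothFunctionTheory.
Variables (R : realType) (n : nat) (M : manifold R n).
Implicit Types (f g : smooth_fun M) (p : M).

Lemma sfun_eq f g : (forall p, f p = g p) -> f = g.
Proof. by move=> fg; apply: val_inj; apply/funext. Qed.

Lemma sfun0E p : (0 : smooth_fun M) p = 0. Proof. by []. Qed.
Lemma sfunDE f g p : (f + g) p = f p + g p. Proof. by []. Qed.
Lemma sfunNE f p : (- f) p = - f p. Proof. by []. Qed.
Lemma sfunME f g p : (f * g) p = f p * g p. Proof. by []. Qed.
Lemma sfunZE a f p : (a *: f) p = a * f p. Proof. by []. Qed.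

Lemma sfun_scaleAl a f g : a *: (f * g) = (a *: f) * g.
Proof. by apply: sfun_eq => p; rewrite !(sfunZE, sfunME) mulrA. Qed.

End SmoothFunctionTheory.

Section VectorFields.
Variables (R : realType) (n : nat) (M : manifold R n).

Definition derivation (D : smooth_fun M -> smooth_fun M) : Prop :=
  linear D /\ forall f g, D (f * g) = f * D g + g * D f.

Definition derivation_pred : {pred smooth_fun M -> smooth_fun M} :=
  fun D => `[< derivation D >].

Lemma derivation_submod : submod_closed derivation_pred.
Proof.
split.
  by apply/asboolP; split=> [a f g|f g];
     apply: sfun_eq => p; rewrite !(sfunDE, sfunZE, sfunME, sfun0E); ring.
move=> a D E /asboolP[Dl Dm] /asboolP[El Em]; apply/asboolP; split=> [b f g|f g];
  apply: sfun_eq => p; rewrite !fctE ?Dl ?El ?Dm ?Em !(sfunDE, sfunZE, sfunME);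
  ring.
Qed.

HB.instance Definition _ := GRing.isSubmodClosed.Build R
  (smooth_fun M -> smooth_fun M)
  derivation_pred (GRing.submod_closed_semi derivation_submod).

(* Vector fields, as derivations of C^oo(M): since M is Hausdorff and second
   countable these are the smooth sections of TM, and the C^oo(M)-multilinear
   maps below are the smooth sections of T^*M and of its second exterior
   power. *)
Record vfield := VField {
  vfield_val :> smooth_fun M -> smooth_fun M;
  vfieldP : vfield_val \in derivation_pred
}.

HB.instance Definition _ := [isSub for vfield_val].
HB.instance Definition _ := [Choice of vfield by <:].
HB.instance Definition _ := [SubChoice_isSubLmodule of vfield by <:].

Implicit Types (X Y Z : vfield) (f g h : smooth_fun M).

Lemma vfield_eq X Y : (forall f, X f = Y f) -> X = Y.
Proof. by move=> XY; apply: val_inj; apply/funext. Qed.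

Lemma vfield_linear X : linear X.
Proof. by have /asboolP[] := vfieldP X. Qed.
Lemma vfieldM X f g : X (f * g) = f * X g + g * X f.
Proof. by have /asboolP[] := vfieldP X. Qed.
Lemma vfieldD X f g : X (f + g) = X f + X g.
Proof. by rewrite -[f]scale1r vfield_linear !scale1r. Qed.
Lemma vfield0 X : X 0 = 0.
Proof. by apply: (addrI (X 0)); rewrite -vfieldD !addr0. Qed.
Lemma vfieldZ X a f : X (a *: f) = a *: X f.
Proof. by rewrite -[a *: f]addr0 vfield_linear vfield0 addr0. Qed.
Lemma vfieldN X f : X (- f) = - X f.
Proof. by rewrite -scaleN1r vfieldZ scaleN1r. Qed.

Lemma vfieldDE X Y f : (X + Y) f = X f + Y f. Proof. by []. Qed.
Lemma vfieldNE X f : (- X) f = - X f. Proof. by []. Qed.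
Lemma vfieldZE a X f : (a *: X) f = a *: X f. Proof. by []. Qed.
Lemma vfield0E f : (0 : vfield) f = 0. Proof. by []. Qed.

(* The C^oo(M)-module structure: (hX)(f) = h X(f). *)
Lemma vscale_subproof h X : (fun f => h * X f) \in derivation_pred.
Proof.
apply/asboolP; split=> [a f g|f g]; apply: sfun_eq => p;
  rewrite ?vfieldM ?vfieldD ?vfieldZ !(sfunDE, sfunZE, sfunME); ring.
Qed.
Definition vscale h X := VField (vscale_subproof h X).

Lemma vbracket_subproof X Y : (fun f => X (Y f) - Y (X f)) \in derivation_pred.
Proof.
apply/asboolP; split=> [a f g|f g]; apply: sfun_eq => p;
  rewrite ?(vfieldM, vfieldD, vfieldZ);
  rewrite !(sfunDE, sfunZE, sfunME, sfunNE); ring.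
Qed.
Definition vbracket X Y := VField (vbracket_subproof X Y).

Lemma vbracketE X Y f : vbracket X Y f = X (Y f) - Y (X f). Proof. by []. Qed.
Lemma vscaleE h X f : vscale h X f = h * X f. Proof. by []. Qed.

Definition vfE := (vbracketE, vscaleE, vfieldDE, vfieldNE, vfieldZE, vfield0E,
  vfieldM, vfieldD, vfieldN, vfieldZ, vfield0).
Definition sfE := (sfun0E, sfunDE, sfunNE, sfunME, sfunZE).

End VectorFields.

Section Forms.
Variables (R : realType) (n : nat) (M : manifold R n).
Implicit Types (X Y Z : vfield M) (f g h : smooth_fun M).

(* C^oo(M)-linearity *)
Definition tensorial1 (a : vfield M -> smooth_fun M) : Prop :=
  forall h X Y, a (vscale h X + Y) = h * a X + a Y.

Definition tensorial1_pred : {pred vfield M -> smooth_fun M} :=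
  fun a => `[< tensorial1 a >].

Lemma tensorial1_submod : submod_closed tensorial1_pred.
Proof.
split.
  by apply/asboolP => h X Y; apply: sfun_eq => p; rewrite !sfE; ring.
move=> c a b /asboolP al /asboolP bl; apply/asboolP => h X Y.
by apply: sfun_eq => p; rewrite !fctE al bl !sfE; ring.
Qed.

HB.instance Definition _ := GRing.isSubmodClosed.Build R
  (vfield M -> smooth_fun M)
  tensorial1_pred (GRing.submod_closed_semi tensorial1_submod).

Record form1 := Form1 {
  form1_val :> vfield M -> smooth_fun M;
  form1P : form1_val \in tensorial1_pred
}.

HB.instance Definition _ := [isSub for form1_val].
HB.instance Definition _ := [Choice of form1 by <:].
HB.instance Definition _ := [SubChoice_isSubLmodule of form1 by <:].

Record form2 := Form2 {
  form2_val :> vfield M -> vfield M -> smooth_fun M;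
  form2_alt : forall X, form2_val X X = 0;
  form2_linearl : forall h X Y Z,
    form2_val (vscale h X + Y) Z = h * form2_val X Z + form2_val Y Z;
  form2_linearr : forall h X Y Z,
    form2_val X (vscale h Y + Z) = h * form2_val X Y + form2_val X Z
}.

Implicit Types (a b : form1) (s : form2).

Definition dform2 s X Y Z : smooth_fun M :=
  X (s Y Z) - Y (s X Z) + Z (s X Y)
  - s (vbracket X Y) Z + s (vbracket X Z) Y - s (vbracket Y Z) X.

Definition closed_form2 s : Prop := forall X Y Z, dform2 s X Y Z = 0.

Lemma form1_eq a b : (forall X, a X = b X) -> a = b.
Proof. by move=> ab; apply: val_inj; apply/funext. Qed.

Lemma vscale1 X : vscale 1 X = X.
Proof. by apply: vfield_eq => f; rewrite vfE mul1r. Qed.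
Lemma vscale_cst c X : vscale (c *: (1 : smooth_fun M)) X = c *: X.
Proof. by apply: vfield_eq => f; rewrite !vfE -sfun_scaleAl mul1r. Qed.

Lemma form1_tensorial a : tensorial1 a.
Proof. by have /asboolP := form1P a. Qed.
Lemma form1D a X Y : a (X + Y) = a X + a Y.
Proof. by rewrite -{1}[X]vscale1 form1_tensorial mul1r. Qed.
Lemma form10 a : a 0 = 0.
Proof. by apply: (addrI (a 0)); rewrite -form1D !addr0. Qed.
Lemma form1V a h X : a (vscale h X) = h * a X.
Proof. by rewrite -[vscale h X]addr0 form1_tensorial form10 addr0. Qed.
Lemma form1Z a c X : a (c *: X) = c *: a X.
Proof. by rewrite -vscale_cst form1V -sfun_scaleAl mul1r. Qed.
Lemma form1N a X : a (- X) = - a X.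
Proof. by rewrite -scaleN1r form1Z scaleN1r. Qed.

Lemma form1DE a b X : (a + b) X = a X + b X. Proof. by []. Qed.
Lemma form1NE a X : (- a) X = - a X. Proof. by []. Qed.
Lemma form1ZE c a X : (c *: a) X = c *: a X. Proof. by []. Qed.
Lemma form10E X : (0 : form1) X = 0. Proof. by []. Qed.

Lemma form2Dl s X Y Z : s (X + Y) Z = s X Z + s Y Z.
Proof. by rewrite -{1}[X]vscale1 form2_linearl mul1r. Qed.
Lemma form2Dr s X Y Z : s X (Y + Z) = s X Y + s X Z.
Proof. by rewrite -{1}[Y]vscale1 form2_linearr mul1r. Qed.
Lemma form20r s X : s X 0 = 0.
Proof. by apply: (addrI (s X 0)); rewrite -form2Dr !addr0. Qed.
Lemma form2Zr s c X Y : s X (c *: Y) = c *: s X Y.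
Proof.
by rewrite -vscale_cst -[vscale _ Y]addr0 form2_linearr form20r addr0
  -sfun_scaleAl mul1r.
Qed.
Lemma form2C s X Y : s Y X = - s X Y.
Proof.
have := form2_alt s (X + Y).
rewrite form2Dl !form2Dr !form2_alt add0r addr0 => /eqP.
by rewrite addr_eq0 => /eqP ->; rewrite opprK.
Qed.

Lemma dfun_subproof f : (fun X => X f) \in tensorial1_pred.
Proof. by apply/asboolP => h X Y; rewrite !vfE. Qed.
Definition dfun f : form1 := Form1 (dfun_subproof f).

Lemma lie_subproof X a :
  (fun Y => X (a Y) - a (vbracket X Y)) \in tensorial1_pred.
Proof.
apply/asboolP => h Y Z.
have -> : vbracket X (vscale h Y + Z) =
    vscale h (vbracket X Y) + vscale (X h) Y + vbracket X Z.
  by apply: vfield_eq => f; apply: sfun_eq => p; rewrite !vfE !sfE; ring.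
rewrite !(form1D, form1V) !vfE; apply: sfun_eq => p; rewrite !sfE; ring.
Qed.
Definition lie_deriv X a : form1 := Form1 (lie_subproof X a).

Lemma dfunE f X : dfun f X = X f. Proof. by []. Qed.
Lemma lieE X a Y : lie_deriv X a Y = X (a Y) - a (vbracket X Y). Proof. by []. Qed.

Definition f1E := (dfunE, lieE, form1DE, form1NE, form1ZE, form10E,
  form1D, form1N, form1Z, form10, form1V).

End Forms.

(** * The two Lie 2-algebras *)

Section Source.
Variables (R : realType) (n : nat) (M : manifold R n) (s : form2 M).
Hypothesis s_closed : closed_form2 s.

(* Sections of E^0 = TM + R. *)
Let E0 : lmodType R := (vfield M * smooth_fun M)%type.

Definition bracketE0 (u v : E0) : E0 :=
  (vbracket u.1 v.1, u.1 v.2 - v.1 u.2 + s u.1 v.1).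

Lemma bracketE0_linear u : linear (bracketE0 u).
Proof.
case: u => X f a [Y g] [Z h]; congr pair => /=.
  by apply: vfield_eq => k; apply: sfun_eq => p; rewrite ?(vfE, sfE) /=; ring.
by apply: sfun_eq => p; rewrite !(vfE, form2Dr, form2Zr) ?sfE /=; ring.
Qed.

Lemma bracketE0_anti u v : bracketE0 v u = - bracketE0 u v.
Proof.
case: u v => X f [Y g]; congr pair => /=.
  by apply: vfield_eq => k; apply: sfun_eq => p; rewrite ?(vfE, sfE); ring.
by apply: sfun_eq => p; rewrite (form2C s X) ?sfE; ring.
Qed.

Lemma bracketE0_jacobi u v w :
  bracketE0 u (bracketE0 v w) + bracketE0 v (bracketE0 w u)
    + bracketE0 w (bracketE0 u v) = 0.
Proof.
case: u v w => X f [Y g] [Z h]; congr pair => /=.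
  by apply: vfield_eq => k; apply: sfun_eq => p; rewrite ?(vfE, sfE) /=; ring.
have := s_closed X Y Z; rewrite /dform2 => /(congr1 (fun k : smooth_fun M => k)) sc.
apply: sfun_eq => p; have := congr1 (fun k : smooth_fun M => k p) sc.
rewrite (form2C s Z (vbracket X Y)) (form2C s Y (vbracket X Z))
  (form2C s X (vbracket Y Z)) (form2C s X Z).
have -> : vbracket Z X = - vbracket X Z.
  by apply: vfield_eq => k; apply: sfun_eq => q; rewrite ?(vfE, sfE); ring.
have -> : s Y (- vbracket X Z) = - s Y (vbracket X Z).
  by rewrite -scaleN1r form2Zr scaleN1r.
rewrite ?vfE ?sfE; lra.
Qed.

Lemma linear_0 (U V : lmodType R) : linear (fun _ : U => 0 : V).
Proof. by move=> c u v; rewrite scaler0 addr0. Qed.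

Lemma bracketE00 u : 0 = bracketE0 u 0.
Proof. by have := bracketE0_linear u (-1) 0 0; rewrite !scaleN1r !addNr. Qed.

(* Concentrated in degree 0: the degree -1 part is the zero space. *)
Definition lie2_E0 : lie2alg R :=
  @Lie2Alg R E0 'rV[R]_0 (fun=> 0) bracketE0 (fun _ _ => 0) (fun _ _ _ => 0)
    (@linear_0 _ _) bracketE0_linear bracketE0_anti
    (fun=> @linear_0 _ _) (fun=> @linear_0 _ _) (fun _ _ => @linear_0 _ _)
    (fun _ _ _ => esym (oppr0 _)) (fun _ _ _ => esym (oppr0 _))
    (fun u _ => bracketE00 u) (fun _ _ => esym (oppr0 _))
    bracketE0_jacobi
    (fun _ _ _ => ltac:(by rewrite !subr0))
    (fun _ _ _ _ => ltac:(by rewrite !(subr0, addr0))).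

End Source.

Section Target.
Variables (R : realType) (n : nat) (M : manifold R n).

(* Sections of E^1 = TM + T^*M. *)
Let E1 : lmodType R := (vfield M * form1 M)%type.
Implicit Types (e : E1) (f g : smooth_fun M).

Definition pairing e1 e2 : smooth_fun M := e2.2 e1.1 + e1.2 e2.1.

Definition courant e1 e2 : E1 :=
  (vbracket e1.1 e2.1,
   lie_deriv e1.1 e2.2 - lie_deriv e2.1 e1.2
   - 2^-1 *: dfun (e2.2 e1.1 - e1.2 e2.1)).

Definition diffE1 f : E1 := (0, dfun f).

Definition br1E1 e f : smooth_fun M := 2^-1 *: pairing e (diffE1 f).

Definition jacE1 e1 e2 e3 : smooth_fun M :=
  - (6^-1 *: (pairing (courant e1 e2) e3 + pairing (courant e2 e3) e1
              + pairing (courant e3 e1) e2)).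

Lemma vbracketC (X Y : vfield M) : vbracket Y X = - vbracket X Y.
Proof.
by apply: vfield_eq => k; apply: sfun_eq => p; rewrite ?(vfE, sfE); ring.
Qed.

Lemma pairingE X Y (a b : form1 M) : pairing (X, a) (Y, b) = b X + a Y.
Proof. by []. Qed.

Lemma courantE X Y (a b : form1 M) : courant (X, a) (Y, b) =
  (vbracket X Y, lie_deriv X b - lie_deriv Y a - 2^-1 *: dfun (b X - a Y)).
Proof. by []. Qed.

Lemma addE1E X Y (a b : form1 M) : (X, a) + (Y, b) = (X + Y, a + b) :> E1.
Proof. by []. Qed.

Lemma dfunvE f X : \val (dfun f) X = X f.
Proof. by []. Qed.

Lemma br1E1E X (a : form1 M) f : br1E1 (X, a) f = 2^-1 *: X f.
Proof.
by apply: sfun_eq => p; rewrite /br1E1 pairingE ?(f1E, vfE) ?sfE addr0.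
Qed.

Lemma jacE1E X Y Z (a b c : form1 M) :
  jacE1 (X, a) (Y, b) (Z, c) = - (4^-1 *: (
    a (vbracket Y Z) + a (vbracket Y Z) + Z (a Y) - Y (a Z)
    + (b (vbracket Z X) + b (vbracket Z X) + X (b Z) - Z (b X))
    + (c (vbracket X Y) + c (vbracket X Y) + Y (c X) - X (c Y)))).
Proof.
apply: sfun_eq => p; rewrite /jacE1 !courantE !pairingE.
rewrite ?(f1E, vfE).
rewrite (vbracketC Y X) (vbracketC Z Y) (vbracketC X Z) ?(f1E, vfE) ?sfE; lra.
Qed.

Lemma vbr_jacobi (X Y Z : vfield M) :
  vbracket X (vbracket Y Z) =
  vbracket (vbracket X Y) Z + vbracket Y (vbracket X Z).
Proof.
by apply: vfield_eq => k; apply: sfun_eq => p; rewrite ?(vfE, sfE); ring.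
Qed.

Lemma diffE1_linear : linear diffE1.
Proof.
move=> c f g; congr pair => /=; first by rewrite scaler0 addr0.
by apply: form1_eq => X; rewrite ?f1E vfE vfieldZ.
Qed.

Lemma courant_linear e : linear (courant e).
Proof.
case: e => X a c [Y b] [Z d]; congr pair => /=.
  by apply: vfield_eq => k; apply: sfun_eq => p; rewrite ?(vfE, sfE) /=; ring.
apply: form1_eq => W; rewrite ?f1E /=.
have -> : vbracket (c *: Y + Z) W = c *: vbracket Y W + vbracket Z W.
  by apply: vfield_eq => k; apply: sfun_eq => p; rewrite ?(vfE, sfE); ring.
by apply: sfun_eq => p; rewrite ?(f1E, vfE) ?sfE; ring.
Qed.

Lemma courant_anti e1 e2 : courant e2 e1 = - courant e1 e2.
Proof.
case: e1 e2 => X a [Y b]; congr pair => /=; first exact: vbracketC.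
apply: form1_eq => W; apply: sfun_eq => p; rewrite ?(f1E, vfE) ?sfE; ring.
Qed.

Lemma br1E1_linear e : linear (br1E1 e).
Proof.
case: e => X a c f g; apply: sfun_eq => p.
rewrite ?br1E1E ?vfE ?sfE; ring.
Qed.

Lemma br1E1_linearl f : linear (br1E1^~ f).
Proof.
move=> c [X a] [Y b]; apply: sfun_eq => p.
rewrite ?br1E1E ?vfE ?sfE; ring.
Qed.

Lemma jacE1_linear e1 e2 : linear (jacE1 e1 e2).
Proof.
case: e1 e2 => X a [Y b] c [Z d] [W k]; apply: sfun_eq => p.
rewrite !jacE1E.
have vl T : vbracket T (c *: Z + W) = c *: vbracket T Z + vbracket T W.
  by apply: vfield_eq => h; apply: sfun_eq => q; rewrite ?(vfE, sfE); ring.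
rewrite !(vbracketC X) !vl !form1DE !form1ZE !(form1N, form1D, form1Z).
rewrite !(vfieldDE, vfieldZE, vfieldD, vfieldZ).
rewrite !(sfunDE, sfunZE, sfunNE); lra.
Qed.

Lemma jacE1_anti12 e1 e2 e3 : jacE1 e2 e1 e3 = - jacE1 e1 e2 e3.
Proof.
case: e1 e2 e3 => X a [Y b] [Z c]; apply: sfun_eq => p; rewrite !jacE1E.
rewrite (vbracketC X Z) (vbracketC Y Z) (vbracketC X Y) ?(f1E, vfE) ?sfE; lra.
Qed.

Lemma jacE1_anti23 e1 e2 e3 : jacE1 e1 e3 e2 = - jacE1 e1 e2 e3.
Proof.
case: e1 e2 e3 => X a [Y b] [Z c]; apply: sfun_eq => p; rewrite !jacE1E.
rewrite (vbracketC X Z) (vbracketC Y Z) (vbracketC X Y) ?(f1E, vfE) ?sfE; lra.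
Qed.

Lemma diffE1_br1 e f : diffE1 (br1E1 e f) = courant e (diffE1 f).
Proof.
case: e => X a; rewrite br1E1E /diffE1 courantE; congr pair.
  by apply: vfield_eq => k; apply: sfun_eq => p; rewrite ?(vfE, sfE); ring.
apply: form1_eq => W; apply: sfun_eq => p.
have v0 : vbracket 0 W = 0.
  by apply: vfield_eq => k; apply: sfun_eq => q; rewrite ?(vfE, sfE); ring.
rewrite ?(f1E, vfE) v0 ?(f1E, vfE) ?sfE; lra.
Qed.

Lemma br1E1_diff f g : br1E1 (diffE1 f) g = - br1E1 (diffE1 g) f.
Proof.
by apply: sfun_eq => p; rewrite ?br1E1E ?vfE ?sfE; ring.
Qed.

Lemma courant_formE X Y (a b : form1 M) V :
  (lie_deriv X b - lie_deriv Y a - 2^-1 *: dfun (b X - a Y)) V =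
  X (b V) - b (vbracket X V) - Y (a V) + a (vbracket Y V)
  - 2^-1 *: V (b X) + 2^-1 *: V (a Y).
Proof.
apply: sfun_eq => q; rewrite !form1DE !form1NE form1ZE !lieE dfunE.
rewrite !(vfieldD, vfieldN) ?sfE; lra.
Qed.

Lemma vbracket_nest (X Y Z : vfield M) : vbracket (vbracket X Y) Z =
  vbracket X (vbracket Y Z) - vbracket Y (vbracket X Z).
Proof.
by apply: vfield_eq => k; apply: sfun_eq => q; rewrite ?(vfE, sfE); ring.
Qed.

Lemma courant_courantE X Y Z (a b c : form1 M) W p :
  (courant (X, a) (courant (Y, b) (Z, c))).2 W p =
  X (Y (c W)) p - X (c (vbracket Y W)) p - X (Z (b W)) p
  + X (b (vbracket Z W)) p - 2^-1 * X (W (c Y)) p + 2^-1 * X (W (b Z)) p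
  - (Y (c (vbracket X W)) p - c (vbracket Y (vbracket X W)) p
     - Z (b (vbracket X W)) p + b (vbracket Z (vbracket X W)) p
     - 2^-1 * (X (W (c Y)) p - W (X (c Y)) p)
     + 2^-1 * (X (W (b Z)) p - W (X (b Z)) p))
  - (Y (Z (a W)) p - Z (Y (a W)) p)
  + a (vbracket Y (vbracket Z W)) p - a (vbracket Z (vbracket Y W)) p
  - 2^-1 * (W (Y (c X)) p - W (c (vbracket Y X)) p - W (Z (b X)) p
            + W (b (vbracket Z X)) p - 2^-1 * W (X (c Y)) p
            + 2^-1 * W (X (b Z)) p)
  + 2^-1 * W (a (vbracket Y Z)) p.
Proof.
rewrite (courantE Y Z) courantE /snd courant_formE vbracket_nest.
rewrite !courant_formE !(form1D, form1N) !(vbracketE Y Z, vbracketE X W).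
rewrite !(vfieldD, vfieldN, vfieldZ) !(sfunNE, sfunDE, sfunZE); lra.
Qed.

Lemma courant_jacobi e1 e2 e3 :
  courant e1 (courant e2 e3) + courant e2 (courant e3 e1)
    + courant e3 (courant e1 e2) = diffE1 (jacE1 e1 e2 e3).
Proof.
case: e1 e2 e3 => X a [Y b] [Z c].
have addV (u v w : E1) k p :
  (u + v + w).1 k p = u.1 k p + v.1 k p + w.1 k p.
  by case: u v w => ? ? [? ?] [? ?]; rewrite !addE1E /fst !vfieldDE !sfunDE.
have addW (u v w : E1) W p :
  (u + v + w).2 W p = u.2 W p + v.2 W p + w.2 W p.
  by case: u v w => ? ? [? ?] [? ?]; rewrite !addE1E /snd !form1DE !sfunDE.
apply: injective_projections.
  apply: vfield_eq => k; apply: sfun_eq => p; rewrite addV.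
  rewrite (courantE Y Z) (courantE Z X) (courantE X Y) !courantE /diffE1 /fst.
  rewrite !(vbracketE, vfieldD, vfieldN) !(sfunDE, sfunNE) vfield0E sfun0E.
  by ring.
apply: form1_eq => W; apply: sfun_eq => p; rewrite addW !courant_courantE.
rewrite /diffE1 /snd dfunE jacE1E.
rewrite (vbracketC Y Z) (vbracketC X Z) (vbracketC X Y) !form1N.
rewrite !(vfieldD, vfieldN, vfieldZ) !(sfunNE, sfunDE, sfunZE); lra.
Qed.

Lemma br1E1_jacobi e1 e2 f :
  br1E1 e1 (br1E1 e2 f) - br1E1 e2 (br1E1 e1 f) - br1E1 (courant e1 e2) f
  = jacE1 e1 e2 (diffE1 f).
Proof.
case: e1 e2 => X a [Y b]; apply: sfun_eq => p.
have v0 U : vbracket 0 U = 0.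
  by apply: vfield_eq => k; apply: sfun_eq => q; rewrite ?(vfE, sfE); ring.
rewrite courantE !br1E1E /diffE1 jacE1E (vbracketC 0) !v0.
rewrite ?(f1E, dfunvE, vfE) ?sfE; lra.
Qed.

Lemma jacE1_courantE X Y Z W (a b c d : form1 M) p :
  jacE1 (courant (X, a) (Y, b)) (Z, c) (W, d) p = - (4^-1 * (
    2 * (X (b (vbracket Z W)) p - b (vbracket X (vbracket Z W)) p
         - Y (a (vbracket Z W)) p + a (vbracket Y (vbracket Z W)) p)
    - (Z (W (b X)) p - W (Z (b X)) p) + (Z (W (a Y)) p - W (Z (a Y)) p)
    + (W (X (b Z)) p - W (b (vbracket X Z)) p - W (Y (a Z)) p
       + W (a (vbracket Y Z)) p - 2^-1 * W (Z (b X)) p + 2^-1 * W (Z (a Y)) p)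
    - (Z (X (b W)) p - Z (b (vbracket X W)) p - Z (Y (a W)) p
       + Z (a (vbracket Y W)) p - 2^-1 * Z (W (b X)) p + 2^-1 * Z (W (a Y)) p)
    + 2 * c (vbracket W (vbracket X Y)) p
    + (X (Y (c W)) p - Y (X (c W)) p) - W (c (vbracket X Y)) p
    - 2 * d (vbracket Z (vbracket X Y)) p
    + Z (d (vbracket X Y)) p - (X (Y (d Z)) p - Y (X (d Z)) p))).
Proof.
rewrite courantE jacE1E (vbracketC Z (vbracket X Y)).
rewrite !courant_formE !form1N !(vbracketE (vbracket X Y), vbracketE Z W, vbracketE X Y).
rewrite !(vfieldD, vfieldN, vfieldZ).
rewrite !(sfunNE, sfunDE, sfunZE); lra.
Qed.

Lemma br1E1_jacE X Y Z W (a b c d : form1 M) p :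
  br1E1 (X, a) (jacE1 (Y, b) (Z, c) (W, d)) p = - (8^-1 * (
    2 * X (b (vbracket Z W)) p + X (W (b Z)) p - X (Z (b W)) p
    - 2 * X (c (vbracket Y W)) p + X (Y (c W)) p - X (W (c Y)) p
    + 2 * X (d (vbracket Y Z)) p + X (Z (d Y)) p - X (Y (d Z)) p)).
Proof.
rewrite br1E1E jacE1E (vbracketC Y W) !form1N.
rewrite !(vfieldD, vfieldN, vfieldZ) !(sfunNE, sfunDE, sfunZE); lra.
Qed.

Lemma form1_jacobi (a : form1 M) X Y Z p :
  a (vbracket X (vbracket Y Z)) p - a (vbracket Y (vbracket X Z)) p
  + a (vbracket Z (vbracket X Y)) p = 0.
Proof.
rewrite -!sfunNE -!sfunDE -form1N -!form1D.
rewrite (_ : _ + _ + _ = 0) ?form10//.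
by apply: vfield_eq => k; apply: sfun_eq => q; rewrite ?(vfE, sfE); ring.
Qed.

Lemma jacE1_coherence e1 e2 e3 e4 :
  br1E1 e1 (jacE1 e2 e3 e4) - br1E1 e2 (jacE1 e1 e3 e4)
    + br1E1 e3 (jacE1 e1 e2 e4) - br1E1 e4 (jacE1 e1 e2 e3)
  = jacE1 (courant e1 e2) e3 e4 - jacE1 (courant e1 e3) e2 e4
    + jacE1 (courant e1 e4) e2 e3 + jacE1 (courant e2 e3) e1 e4
    - jacE1 (courant e2 e4) e1 e3 + jacE1 (courant e3 e4) e1 e2.
Proof.
case: e1 e2 e3 e4 => X a [Y b] [Z c] [W d]; apply: sfun_eq => p.
have L (f1 f2 f3 f4 : smooth_fun M) :
  (f1 - f2 + f3 - f4) p = f1 p - f2 p + f3 p - f4 p by [].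
have L' (f1 f2 f3 f4 f5 f6 : smooth_fun M) :
  (f1 - f2 + f3 + f4 - f5 + f6) p = f1 p - f2 p + f3 p + f4 p - f5 p + f6 p.
  by [].
rewrite L L' !jacE1_courantE !br1E1_jacE.
rewrite (vbracketC X Y) (vbracketC X Z) (vbracketC X W) (vbracketC Y Z)
  (vbracketC Y W) (vbracketC Z W).
rewrite !(form1N, vfieldN, sfunNE).
have := (form1_jacobi a Y Z W p, form1_jacobi b X Z W p,
  form1_jacobi c X Y W p, form1_jacobi d X Y Z p).
case=> [[[Ja Jb] Jc] Jd]; lra.
Qed.

Definition lie2_E1 : lie2alg R :=
  @Lie2Alg R E1 (smooth_fun M) diffE1 courant br1E1 jacE1
    diffE1_linear courant_linear courant_anti br1E1_linear br1E1_linearl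
    jacE1_linear jacE1_anti12 jacE1_anti23 diffE1_br1 br1E1_diff
    courant_jacobi br1E1_jacobi jacE1_coherence.

End Target.

Arguments lie2_E1 {R n} M.

(* Main.v *)
Require Import Defs.
From mathcomp Require Import all_boot all_order all_algebra.
From mathcomp Require Import ring lra.
From mathcomp Require Import all_classical all_reals all_analysis.

Import Order.TTheory GRing.Theory Num.Theory.

Local Open Scope ring_scope.

(** On sections of the form X + df the Courant structure collapses.  Since
    L_X commutes with d, the one-form part of [[X + df, Y + dg]] is
    d(Xg - Yf) minus half of itself, so [phi0] fails to preserve brackets by
    d(1/2 (Xg - Yf) + sigma(X, Y)), which is exactly d o phi2.  Likewise J'
    reduces to minus a quarter of the cyclic sum of [Y,Z]f.  In the last axiom
    the terms in f, g, h and those in sigma separate.  In the function terms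
    the cyclic sum of X(Yh - Zg) equals that of [Y,Z]f: these cancel in the
    terms phi2(x, [y,z]), and the terms [phi0 x, phi2(y,z)]' contribute
    another factor 1/2 to the 1/2 of phi2, which gives the quarter.  The sigma
    terms add up to d sigma: X(sigma(Y,Z)) appears once with weight 1/2 through
    the bracket of E^0 inside phi2, once with weight 1/2 through the bracket
    with a function, and sigma(X, [Y,Z]) appears once. *)

Section ExactSections.
Variables (R : realType) (n : nat) (M : manifold R n).
Implicit Types (X Y Z : vfield M) (f g h : smooth_fun M).

Lemma dfun_linear : linear (@dfun R n M).
Proof. by move=> a f g; apply: form1_eq => X; rewrite ?f1E vfieldD vfieldZ. Qed.

Lemma lie_deriv_dfun X g : lie_deriv X (dfun g) = dfun (X g).
Proof.
apply: form1_eq => W; rewrite lieE !dfunE vbracketE.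
by apply: sfun_eq => p; rewrite ?sfE; ring.
Qed.

(** The two Lie derivatives contribute d(Xg - Yf), and the antisymmetrizing
    term of the bracket removes half of it. *)
Lemma courant_dfun X Y f g :
  courant (X, dfun f) (Y, dfun g)
  = (vbracket X Y, 2^-1 *: dfun (X g - Y f)).
Proof.
rewrite courantE !lie_deriv_dfun !dfunE; congr pair.
apply: form1_eq => W; apply: sfun_eq => p.
rewrite ?f1E ?vfieldD ?vfieldN ?sfE; lra.
Qed.

(** The pairing of [[e1, e2]] with e3 is [X,Y]h + 1/2 Z(Xg - Yf), and the cyclic
    sum of the second terms is half that of the first: the coefficient 1/4 is
    1/6 * (1 + 1/2). *)
Lemma jacE1_dfun X Y Z f g h :
  jacE1 (X, dfun f) (Y, dfun g) (Z, dfun h)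
  = - (4^-1 *: (vbracket Y Z f + vbracket Z X g + vbracket X Y h)).
Proof.
rewrite jacE1E !dfunE !vbracketE; apply: sfun_eq => p; rewrite ?sfE; lra.
Qed.

End ExactSections.

(** Closedness in its cyclic form, the one in which the coherence identity of
    the morphism produces it. *)
Lemma closed_form2_cyclic (R : realType) (n : nat) (M : manifold R n)
    (s : form2 M) (X Y Z : vfield M) : closed_form2 s ->
  X (s Y Z) - Y (s X Z) + Z (s X Y)
  + s X (vbracket Y Z) - s Y (vbracket X Z) + s Z (vbracket X Y) = 0.
Proof.
move=> /(_ X Y Z) <-; rewrite /dform2.
rewrite (form2C s Z (vbracket X Y)) (form2C s Y (vbracket X Z)).
by rewrite (form2C s X (vbracket Y Z)); apply: sfun_eq => p; rewrite ?sfE; ring.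
Qed.

Theorem theorem7p1 (R : realType) (n : nat) (M : manifold R n)
    (sigma : form2 M) (sigma_closed : closed_form2 sigma) :
  lie2_morphism (L := lie2_E0 sigma_closed) (L' := lie2_E1 M)
    (fun u : vfield M * smooth_fun M => (u.1, dfun u.2))
    (fun=> 0)
    (fun u v : vfield M * smooth_fun M =>
       2^-1 *: (u.1 v.2 - v.1 u.2) + sigma u.1 v.1).
Proof.
split=> /=.
- by move=> a [X f] [Y g]; congr pair; apply: dfun_linear.
- exact: linear_0.
- move=> [X f] a [Y g] [Z h] /=; rewrite form2Dr form2Zr.
  by apply: sfun_eq => p; rewrite ?vfE ?sfE; ring.
- move=> [X f] [Y g] /=; rewrite (form2C sigma X Y).
  by apply: sfun_eq => p; rewrite ?sfE; ring.
- by [].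
- move=> [X f] [Y g]; rewrite courant_dfun /diffE1 /=; congr pair.
    by rewrite subrr.
  apply: form1_eq => W; apply: sfun_eq => p.
  rewrite ?f1E ?vfE ?sfE; lra.
- move=> _ [Y g]; rewrite /brm1 /=.
  rewrite br1E1E vfield0 (form2C sigma Y 0) form20r.
  by apply: sfun_eq => p; rewrite ?vfE ?sfE; ring.
- move=> [X f] [Y g] [Z h] /=; rewrite jacE1_dfun !br1E1E.
  apply: sfun_eq => p.
  have := congr1 (fun k : smooth_fun M => k p)
    (closed_form2_cyclic _ _ _ _ X Y Z sigma_closed).
  rewrite ?vfE ?sfE; lra.
Qed.
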